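(* For any finite relational signature $\tau$ there exists a signature $\tau_1$ consisting of a single relation symbol such that, for any $\mathrm{GMSNP}$ $\tau$-sentence $\Phi$, there exists a $\mathrm{GMSNP}$ $\tau_1$-sentence $\Phi^1$ such that $\mathrm{Sat}(\Phi)$ and $\mathrm{Sat}(\Phi^1)$ are polynomial-time equivalent.
   Context: An $\mathrm{SNP}$ $\tau$-sentence is written in the form $\exists X_1,\ldots,X_s\,\forall \mathbf{x}\,\bigwedge_i \neg(\alpha_i\wedge\beta_i\wedge\epsilon_i)$, where $\sigma=\{X_1,\dots,X_s\}$ are existentially quantified relation symbols, each $\alpha_i$ is a conjunction of atomic or negated atomic $\tau$-formulas, each $\beta_i$ a conjunction of atomic or negated atomic $\sigma$-formulas, and each $\epsilon_i$ a conjunction of inequalities between variables; each $\neg(\alpha_i\wedge\beta_i\wedge\epsilon_i)$ is a negated conjunct. A sentence of this form is in $\mathrm{GMSNP}$ (guarded monotone SNP) if each $\alpha_i$ is a conjunction of nonnegated $\tau$-atoms, each $\beta_i$ is a conjunction of $\sigma$-atoms or negated $\sigma$-atoms (of any arity), each $\epsilon_i$ is empty, and for every negated $\sigma$-atom $\neg X(\mathbf{x}_1)$ in $\beta_i$ there exists either a $\tau$-atom $R(\mathbf{x}_2)$ in $\alpha_i$ or a nonnegated $\sigma$-atom $X'(\mathbf{x}_2)$ in $\beta_i$ with every variable of $\mathbf{x}_1$ occurring in $\mathbf{x}_2$. $\mathrm{Sat}(\Phi)$ denotes the set of finite $\tau$-structures satisfying $\Phi$. Polynomial-time equivalence means polynomial-time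 many-one reducibility in both directions. Sentences are assumed nontrivial (having both YES and NO finite instances). *)

(* Defs.v *)
From mathcomp Require Import all_boot.

Set Implicit Arguments.
Unset Strict Implicit.
Unset Printing Implicit Defensive.

(** * Finite relational structures *)

Record signature := Signature { symbol :> finType; arity : symbol -> nat }.

(* An atom [R(x_1, ..., x_r)] over the set [V]. With [V] a set of variables
   this is an atomic formula; with [V] the domain of a structure it is a fact.
   Equality atoms are not included. *)
Definition atom (S : signature) (V : Type) : Type :=
  {R : S & (arity R).-tuple V}.

Definition interpretation (S : signature) (D : finType) : Type :=
  forall R : S, {set (arity R).-tuple D}.

Record structure (S : signature) := Structure {
  dom : finType;
  interp : interpretation S dom;
  dom_nonempty : 0 < #|dom| }.

Definition holds (S : signature) (D : finType) (I : interpretation S D)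
    (a : atom S D) : bool :=
  tagged a \in I (tag a).

(** * SNP and GMSNP sentences *)

(* The Boolean is the sign: [(true, a)] is [a] and [(false, a)] is its
   negation. *)
Definition literal (S : signature) (V : Type) : Type := (bool * atom S V)%type.

(* The triple [(alpha, beta, epsilon)] of a negated conjunct; an entry [(x, y)]
   of [neqs] is the inequality [x != y]. *)
Record conjunct (tau sigma : signature) (V : Type) := Conjunct {
  input_lits : seq (literal tau V);
  exist_lits : seq (literal sigma V);
  neqs : seq (V * V) }.

(* [exists X_1 ... X_s, forall x_1 ... x_n, /\_i ~ (alpha_i /\ beta_i /\
   epsilon_i)], where [exist_sig] is the set of the [X_j]. *)
Record snp (tau : signature) := Snp {
  exist_sig : signature;
  nvars : nat;
  conjuncts : seq (conjunct tau exist_sig 'I_nvars) }.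

Definition atom_subst (S : signature) (V W : Type) (h : V -> W)
    (a : atom S V) : atom S W :=
  Tagged (fun R : S => (arity R).-tuple W) (map_tuple h (tagged a)).

Definition lit_true (S : signature) (V : Type) (D : finType)
    (I : interpretation S D) (h : V -> D) (l : literal S V) : bool :=
  holds I (atom_subst h l.2) == l.1.

Definition conjunct_true (tau sigma : signature) (V : Type) (D : finType)
    (I : interpretation tau D) (J : interpretation sigma D) (h : V -> D)
    (c : conjunct tau sigma V) : bool :=
  [&& all (lit_true I h) (input_lits c),
      all (lit_true J h) (exist_lits c) &
      all (fun xy => h xy.1 != h xy.2) (neqs c)].

Definition Sat (tau : signature) (Phi : snp tau) (A : structure tau) : Prop :=
  exists J : interpretation (exist_sig Phi) (dom A),
    forall h : 'I_(nvars Phi) -> dom A,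
      all (fun c => ~~ conjunct_true (@interp _ A) J h c) (conjuncts Phi).

Definition nontrivial (tau : signature) (Phi : snp tau) : Prop :=
  (exists A, Sat Phi A) /\ (exists A, ~ Sat Phi A).

Definition vars (S : signature) (V : Type) (a : atom S V) : seq V := tagged a.

Definition guards (S S' : signature) (V : eqType) (b : atom S' V)
    (a : atom S V) : bool :=
  all (fun x => x \in vars b) (vars a).

Definition gm_conjunct (tau sigma : signature) (V : eqType)
    (c : conjunct tau sigma V) : bool :=
  [&& all (fun l => l.1) (input_lits c),
      nilp (neqs c) &
      all (fun l => ~~ l.1 ==>
             has (fun g => guards g.2 l.2) (input_lits c)
             || has (fun g => g.1 && guards g.2 l.2) (exist_lits c))
          (exist_lits c)].

Definition gmsnp (tau : signature) (Phi : snp tau) : bool :=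
  all (@gm_conjunct _ _ _) (conjuncts Phi).

(** * Polynomial-time computable functions on binary words *)

Inductive move := Left | Stay | Right.

(* Deterministic Turing machines with [ntapes.+1] two-way infinite tapes. The
   tape alphabet consists of the blank [None], the bits [Some (inl b)] and the
   auxiliary symbols [Some (inr g)]. *)
Record machine := Machine {
  ntapes : nat;
  aux : finType;
  state : finType;
  start : state;
  halting : pred state;
  trans : state -> {ffun 'I_ntapes.+1 -> option (bool + aux)} ->
    state * {ffun 'I_ntapes.+1 -> option (bool + aux) * move} }.

Section Run.

Variable M : machine.

Definition cell : Type := option (bool + aux M).

(* [(l, r)] is the tape whose cells left of the head are [l], nearest first,
   and whose cells from the head rightwards are [r]; all cells beyond these
   lists are blank. *)
Definition tape : Type := (seq cell * seq cell)%type.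

Definition read (t : tape) : cell := head None t.2.

Definition write_move (t : tape) (am : cell * move) : tape :=
  let: (l, r) := (t.1, am.1 :: behead t.2) in
  match am.2 with
  | Left => (behead l, head None l :: r)
  | Stay => (l, r)
  | Right => (am.1 :: l, behead r)
  end.

Definition config : Type := (state M * ('I_(ntapes M).+1 -> tape))%type.

Definition step (c : config) : config :=
  if halting c.1 then c else
  let: (q, act) := trans c.1 [ffun i => read (c.2 i)] in
  (q, fun i => write_move (c.2 i) (act i)).

Definition init (w : seq bool) : config :=
  (start M, fun i =>
     if i == ord0 then ([::], [seq Some (inl b) | b <- w]) else ([::], [::])).

Fixpoint leading_bits (s : seq cell) : seq bool :=
  if s is Some (inl b) :: s' then b :: leading_bits s' else [::].

(* The output is the maximal word of bits that starts under the head of the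
   last tape. *)
Definition output (c : config) : seq bool := leading_bits (c.2 ord_max).2.

Definition computes_within (w u : seq bool) (t : nat) : Prop :=
  let c := iter t step (init w) in halting c.1 /\ output c = u.

End Run.

Definition poly_time (f : seq bool -> seq bool) : Prop :=
  exists (M : machine) (c d : nat), forall w,
    computes_within M w (f w) (c * size w ^ d + c).

(** * Reductions between classes of finite structures *)

Definition unary (n : nat) : seq bool := rcons (nseq n true) false.

(* The numbers naming the symbol and the elements of a fact; its end is
   determined by the arity of the symbol. *)
Definition fact_code (S : signature) (D : finType) (a : atom S D) : seq nat :=
  (enum_rank (tag a) : nat) :: [seq (enum_rank x : nat) | x <- vars a].

(* A structure is presented by its number of elements and a list of its facts,
   in any order and possibly with repetitions, all numbers being in unary. *)
Definition encodes (S : signature) (A : structure S) (w : seq bool) : Prop :=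
  exists s : seq {R : S & (arity R).-tuple (dom A)},
    (forall a, (a \in s) = holds (@interp _ A) a) /\
    w = flatten
          (map unary (#|dom A| :: flatten (map (@fact_code S (dom A)) s))).

(* Polynomial-time many-one reducibility. *)
Definition poly_reducible (S S' : signature)
    (K : structure S -> Prop) (K' : structure S' -> Prop) : Prop :=
  exists f : seq bool -> seq bool, poly_time f /\
    forall A w, encodes A w ->
      exists B, encodes B (f w) /\ (K A <-> K' B).

Definition poly_equivalent (S S' : signature)
    (K : structure S -> Prop) (K' : structure S' -> Prop) : Prop :=
  poly_reducible K K' /\ poly_reducible K' K.

(* Main.v *)
From HB Require Import structures.
Require Import Defs.
From mathcomp Require Import all_boot zify.

Set Implicit Arguments.
Unset Strict Implicit.
Unset Printing Implicit Defensive.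

(* The single symbol P has, for every symbol R of tau, a block of positions made
   of two flags and one position per argument of R. The atom R(x) is expressed by
   a P-atom whose two R-flags are the same variable, whose R-arguments are x, and
   whose other positions are fresh variables; since only more variables occur in
   the atom, guardedness is preserved. Reading the facts of a P-structure B this
   way gives a tau-structure on the same domain that satisfies Phi iff B satisfies
   Phi1. Conversely a tau-structure A is turned into a P-structure by one fact per
   fact of A, whose flags are equal in one block only; the unequal flags need two
   elements, one of which is new. Decoding the result gives back A plus an
   isolated element, which is irrelevant to a GMSNP sentence: negated atoms are
   guarded, so a variable sent to the isolated element occurs in no literal of a
   violated conjunct.

   Both translations act fact by fact and only need copying of unary numbers,
   output of constants and, for decoding, comparison of two numbers; they are run
   by one linear-time interpreter whose work tape is a counter. *)

(** * An interpreter with one counter *)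

Inductive instr := Emit of bool | Copy | Mark | Count | Compare.

(** Needed to make [instr] a finite type, since continuations become part of the states of a Turing
    machine. *)
Definition instr_code (i : instr) : bool + 'I_4 :=
  match i with
  | Emit b => inl b
  | Copy => inr (inord 0)
  | Mark => inr (inord 1)
  | Count => inr (inord 2)
  | Compare => inr (inord 3)
  end.

Definition instr_decode (x : bool + 'I_4) : instr :=
  match x with
  | inl b => Emit b
  | inr i => nth Copy [:: Copy; Mark; Count; Compare] i
  end.

Lemma instr_codeK : cancel instr_code instr_decode.
Proof. by case=> //=; rewrite inordK. Qed.

HB.instance Definition _ := Finite.copy instr (can_type instr_codeK).

Inductive counter_op := Keep | ToZero | Incr | Decr.

Section Interpreter.

(** [hdr] handles the leading number, the size of the domain; [prog k] handles the arguments of each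
    fact whose symbol has number [k]. *)
Variables (t : nat) (hdr : seq instr) (prog : 'I_t.+1 -> seq instr).

(* With an empty continuation the symbol of the next fact is being read and
   [symb] counts its digits; a false [flag] suppresses all output. *)
Record control := Control {
  flag : bool; symb : 'I_t.+1; cont : seq instr }.

Record action := Action {
  next : control; consume : bool; emit : option bool; ctr_op : counter_op }.

(** [None] means that the run stops. [Emit] and [Mark] read nothing; [Copy] and [Count] remain in
    front of the continuation until the final [false] of the number. Reading the end of a symbol
    sets the flag again, so a silenced fact does not affect the next one. *)
Definition delta (x : option bool) (zero : bool) (q : control) : option action :=
  let: Control fl k p := q in
  match p, x with
  | Emit b :: p', _ =>
    Some (Action (Control fl k p') false (if fl then Some b else None) Keep)
  | Mark :: p', _ => Some (Action (Control fl k p') false None ToZero)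
  | _, None => None
  | [::], Some true => Some (Action (Control fl (inord k.+1) [::]) true None Keep)
  | [::], Some false => Some (Action (Control true ord0 (prog k)) true None Keep)
  | Copy :: p', Some b =>
    Some (Action (Control fl k (if b then p else p')) true
                 (if fl then Some b else None) Keep)
  | Count :: p', Some b =>
    Some (Action (Control fl k (if b then p else p')) true None
                 (if b then Incr else Keep))
  | Compare :: p', Some false => Some (Action (Control zero k p') true None Keep)
  (* The number read exceeds the counter: its remaining digits are skipped by a
     copy that the flag silences. *)
  | Compare :: p', Some true =>
    if zero then Some (Action (Control false k (Copy :: p')) true None Keep)
    else Some (Action (Control fl k p) true None Decr)
  end.

Record aconf := AConf {
  ctl : control; ctr : nat; inp : seq bool; out : seq bool }.

Definition apply_op (o : counter_op) (n : nat) : nat :=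
  match o with Keep => n | ToZero => 0 | Incr => n.+1 | Decr => n.-1 end.

Definition anext (a : aconf) : option action :=
  delta (ohead (inp a)) (ctr a == 0) (ctl a).

Definition astep (a : aconf) : aconf :=
  if anext a is Some c then
    AConf (next c) (apply_op (ctr_op c) (ctr a))
          (if consume c then behead (inp a) else inp a)
          (out a ++ seq_of_opt (emit c))
  else a.

(** No continuation in a run exceeds this length, which is what keeps the control finite. *)
Definition bound : nat := maxn (size hdr) (\max_(k : 'I_t.+1) size (prog k)).

(** A termination measure: a step either shortens the continuation or consumes a letter, and a
    consumed letter pays for loading a program of length at most [bound]. *)
Definition weight (a : aconf) : nat :=
  bound.+1 * size (inp a) + size (cont (ctl a)).

Definition init_conf (w : seq bool) : aconf := AConf (Control true ord0 hdr) 0 w [::].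

Definition interp_fun (w : seq bool) : seq bool :=
  let a := init_conf w in out (iter (weight a) astep a).

Lemma weight_astep a : anext a -> weight (astep a) < weight a.
Proof.
rewrite /astep; case E: (anext a) => [c|//] _; move: E.
rewrite /anext /weight; case: a => [[fl k p] n w o] /=.
have Hk : size (prog k) <= bound.
  by rewrite leq_max (leq_bigmax (F := fun k => size (prog k))) ?orbT.
case: p => [|[b||||] p]; case: w => [|[] w] //=; rewrite ?mulnS;
  try (by case=> <- /=; lia).
by case: (n == 0) => -[<-] /=; lia.
Qed.

Lemma iter_stopped n a : ~~ anext a -> iter n astep a = a.
Proof.
move=> Ha; elim: n => //= n ->.
by rewrite /astep; case: (anext a) Ha.
Qed.

Lemma iter_weight_stops n a : weight a <= n -> ~~ anext (iter n astep a).
Proof.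
elim: n a => [|n IH] a Ha /=.
  by apply/negP => /weight_astep; lia.
rewrite -iterS iterSr; case E: (anext a) => [c|].
  by apply: IH; have := @weight_astep a; rewrite E => /(_ isT); lia.
have Hs : ~~ anext a by rewrite E.
by rewrite -iterSr iter_stopped.
Qed.

Lemma bound_astep a :
  size (cont (ctl a)) <= bound -> size (cont (ctl (astep a))) <= bound.
Proof.
rewrite /astep; case E: (anext a) => [c|//]; move: E.
rewrite /anext; case: a => [[fl k p] n w o] /=.
have Hk : size (prog k) <= bound.
  by rewrite leq_max (leq_bigmax (F := fun k => size (prog k))) ?orbT.
case: p => [|[b||||] p]; case: w => [|[] w] //=;
  try (by case=> <- /=; lia).
by case: (n == 0) => -[<-] /=; lia.
Qed.

(** * The Turing machine *)

Definition work : 'I_3 := inord 1.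

Definition bcontrol : Type := (bool * 'I_t.+1 * bound.-bseq instr)%type.

Definition encode_control (q : control) : bcontrol :=
  (flag q, symb q, insub_bseq bound (cont q)).

Definition decode_control (q : bcontrol) : control :=
  Control q.1.1 q.1.2 q.2.

(** [Boot] writes the first counter mark. [Rewind] moves the output head back to the first letter,
    where [output] starts reading. *)
Inductive phase := Boot | Rewind | Halt.

Definition phase_code (x : phase) : option bool :=
  match x with Boot => None | Rewind => Some true | Halt => Some false end.

Definition phase_decode (x : option bool) : phase :=
  match x with None => Boot | Some true => Rewind | Some false => Halt end.

Lemma phase_codeK : cancel phase_code phase_decode. Proof. by case. Qed.

HB.instance Definition _ := Finite.copy phase (can_type phase_codeK).

Definition tcell : Type := option (bool + void).

Definition bit (b : bool) : tcell := Some (inl b).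

Definition bit_of (c : tcell) : option bool :=
  if c is Some (inl b) then Some b else None.

Definition work_action (c : tcell) (o : counter_op) : tcell * move :=
  match o with
  | Keep => (c, Stay)
  | ToZero => (bit true, Stay)
  | Incr => (c, Right)
  | Decr => (c, Left)
  end.

Definition acts (a0 a1 a2 : tcell * move) : {ffun 'I_3 -> tcell * move} :=
  [ffun i : 'I_3 => nth a0 [:: a0; a1; a2] i].

Definition tm_trans (q : bcontrol + phase) (c : {ffun 'I_3 -> tcell}) :
    (bcontrol + phase) * {ffun 'I_3 -> tcell * move} :=
  let c0 := c ord0 in let c1 := c work in let c2 := c ord_max in
  match q with
  | inr Boot =>
    (inl (encode_control (Control true ord0 hdr)),
     acts (c0, Stay) (bit true, Stay) (c2, Stay))
  | inl q =>
    match delta (bit_of c0) (c1 == bit true) (decode_control q) with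
    | Some a =>
      (inl (encode_control (next a)),
       acts (c0, if consume a then Right else Stay) (work_action c1 (ctr_op a))
            (if emit a is Some b then (bit b, Right) else (c2, Stay)))
    | None => (inr Rewind, acts (c0, Stay) (c1, Stay) (c2, Left))
    end
  | inr Rewind =>
    if c2 is None then (inr Halt, acts (c0, Stay) (c1, Stay) (c2, Right))
    else (inr Rewind, acts (c0, Stay) (c1, Stay) (c2, Left))
  | inr Halt => (inr Halt, acts (c0, Stay) (c1, Stay) (c2, Stay))
  end.

Definition tm : machine :=
  @Machine 2 void (bcontrol + phase)%type (inr Boot)
    (fun q => q == inr Halt) tm_trans.

Definition blank (s : seq tcell) : bool := all (pred1 None) s.

(* The counter is the distance from the head to the nearest mark on its left;
   the marks left behind by earlier counts lie further to the left. *)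
Definition counter_tape (n : nat) (s : tape tm) : Prop :=
  [/\ exists r, read s :: s.1 = nseq n None ++ bit true :: r &
      blank (behead s.2)].

(** The blanks [z] are those written back when the input head stands past the end of the word. The
    output head stands just behind the word produced so far. *)
Definition simulates (a : aconf) (c : config tm) : Prop :=
  [/\ size (cont (ctl a)) <= bound,
      c.1 = inl (encode_control (ctl a)),
      exists2 z, blank z & (c.2 (@ord0 2)).2 = map bit (inp a) ++ z,
      counter_tape (ctr a) (c.2 work) &
      (c.2 (@ord_max 2)).1 = map bit (rev (out a)) /\ blank (c.2 (@ord_max 2)).2].

Lemma blank_read s : blank s -> head None s = None.
Proof. by case: s => //= c s /andP[/eqP]. Qed.

Lemma step_running (c : config tm) q : c.1 = inl q ->
  step c =
  let: (q', act) := tm_trans (inl q) [ffun i => read (c.2 i)] in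
  (q', fun i => write_move (c.2 i) (act i)).
Proof. by case: c => c1 c2 /= ->. Qed.

Lemma encode_controlK q : size (cont q) <= bound ->
  decode_control (encode_control q) = q.
Proof.
case: q => fl k p Hp; rewrite /encode_control /decode_control /=.
by rewrite insubdK.
Qed.

Lemma read_input w z : blank z -> bit_of (head None (map bit w ++ z)) = ohead w.
Proof. by case: w => //= /blank_read ->. Qed.

Lemma counter_read n (s : tape tm) : counter_tape n s ->
  (read s == bit true) = (n == 0).
Proof. by case=> -[r]; case: n => [|n] [-> _] _. Qed.

(** An increment moves onto a blank cell, since all cells right of the head are blank. A decrement
    leaves a blank cell behind, since a nonzero counter means that the head is not on a mark. *)
Lemma counter_tape_op n (s : tape tm) o : counter_tape n s ->
  (o = Decr -> n != 0) ->
  counter_tape (apply_op o n) (write_move s (work_action (read s) o)).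
Proof.
case: s => l r [[r']]; rewrite /read /= => Hl Hr Hn.
have Hr2 : blank (behead (behead r)) by case: (behead r) Hr => //= x s /andP[].
case: o Hn => /= Hn; rewrite /write_move /=.
- by split; [exists r'|].
- by split; [exists l|].
- split => //; exists r'; rewrite /read /= -Hl /=.
  by rewrite blank_read.
- case: n Hn Hl => [/(_ erefl)//|n] _ /= [H0 Hl]; split.
    by exists r'; rewrite /read /= -Hl; case: (l) Hl => //; case: (n).
  by rewrite /blank /= H0.
Qed.

Lemma anext_decr a c : anext a = Some c -> ctr_op c = Decr -> ctr a != 0.
Proof.
rewrite /anext; case: a => [[fl k p] n w o] /=.
by case: p => [|[b||||] p]; case: w => [|[] w] //=; do ?[by case=> <-];
  case: (n == 0) => // -[<-].
Qed.

Lemma anext_consume a c : anext a = Some c -> consume c -> inp a != [::].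
Proof.
rewrite /anext; case: a => [[fl k p] n w o] /=.
by case: p => [|[b||||] p]; case: w => [|[] w] //=; case=> <-.
Qed.

Lemma actsE a0 a1 a2 :
  (acts a0 a1 a2 ord0 = a0) * (acts a0 a1 a2 work = a1) * (acts a0 a1 a2 ord_max = a2).
Proof. by rewrite /acts !ffunE /= inordK. Qed.

Lemma simulates_step a c : simulates a c -> anext a -> simulates (astep a) (step c).
Proof.
move=> [Hb H1 [z Hz H2] H3 [H4 H5]] Ha; rewrite (step_running H1) /tm_trans.
have Hb' := bound_astep Hb.
rewrite !ffunE encode_controlK // (counter_read H3) [read (c.2 ord0)]/read H2.
rewrite read_input //; move: Hb' Ha.
rewrite /astep; case E: (anext a) => [d|//]; rewrite /anext in E.
rewrite E => Hb' _; split => //=.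
- rewrite !actsE /write_move /= H2.
  have := @anext_consume a d E; case: (consume d) => /=.
    by move=> /(_ isT); case: (inp a) => //= b w _; exists z.
  move=> _; case: (inp a) => [|b w] /=; last by exists z.
  exists (head None z :: behead z) => //.
  by case: (z) Hz => //= x s /andP[/eqP->].
- rewrite !actsE; apply: counter_tape_op => //; exact: anext_decr.
- rewrite !actsE; case: (emit d) => [b|] /=.
    rewrite /write_move /= rev_cat /= H4; split=> //.
    by case: (c.2 ord_max).2 H5 => //= x s /andP[].
  rewrite /write_move /= cats0 H4; split => //.
  rewrite /read blank_read //.
  by case: (c.2 ord_max).2 H5 => //= x s /andP[].
Qed.

(** [l] lists the output bits from the head leftwards, nearest first, and [r] those already passed;
    the word on the tape is [rev l ++ r]. *)
Definition rewinding (l r : seq bool) (c : config tm) : Prop :=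
  c.1 = inr Rewind /\
  exists2 z, blank z & (c.2 ord_max) =
    (behead (map bit l), head None (map bit l) :: map bit r ++ z).

Lemma rewinding_halts l r c : rewinding l r c ->
  let c' := iter (size l).+1 (@step tm) c in
  halting c'.1 /\ output c' = rev l ++ r.
Proof.
elim: l r c => [|b l IH] r [q T] [Hq [z Hz E]]; rewrite /= in Hq E; subst q.
  rewrite /step /= !ffunE E /= /output /= actsE E /write_move /=.
  split => //; elim: r {E} => [|b r /= -> //]; by case: z Hz => //= x s /andP[/eqP->].
rewrite iterSr rev_cons cat_rcons; apply: IH.
rewrite /step /= !ffunE E /=; split => //; exists z => //=.
by rewrite actsE E /write_move /=.
Qed.

Lemma simulates_stopped a c : simulates a c -> ~~ anext a ->
  let c' := iter (size (out a)).+2 (@step tm) c in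
  halting c'.1 /\ output c' = out a.
Proof.
move=> [Hb H1 [z Hz H2] H3 [H4 H5]] Ha c'.
have -> : out a = rev (rev (out a)) ++ [::] by rewrite cats0 revK.
rewrite /c' -(size_rev (out a)) iterSr; apply: rewinding_halts.
rewrite (step_running H1) /tm_trans.
rewrite !ffunE encode_controlK // (counter_read H3) [read (c.2 ord0)]/read H2.
rewrite read_input //; move: Ha.
rewrite /anext; case: (delta _ _ _) => //= _; split => //.
rewrite /= actsE /write_move /= H4; exists (None :: behead (c.2 ord_max).2).
  by case: (c.2 ord_max).2 H5 => //= x s /andP[].
by have -> : read (c.2 ord_max) = None by exact: blank_read.
Qed.

(** The machine may take fewer steps than [n]: a stopped interpreter idles under [astep], whereas
    the machine would start to rewind. The bound on the output limits the cost of rewinding. *)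
Lemma simulates_iter n a c : simulates a c -> weight a <= n ->
  exists j, [/\ j <= n, simulates (iter n astep a) (iter j (@step tm) c) &
    size (out (iter n astep a)) <= size (out a) + n].
Proof.
elim: n a c => [|n IH] a c Hs Hn; first by exists 0; split=> //; rewrite addn0.
have [Ha|Ha] := boolP (isSome (anext a)); last first.
  by exists 0; rewrite iter_stopped //; split=> //; lia.
have Hw := weight_astep Ha.
have [||j [Hj Hsj Ho]] := IH (astep a) (step c); [exact: simulates_step|lia|].
exists j.+1; rewrite !iterSr; split=> //; apply: leq_trans Ho _.
rewrite /astep; case: (anext a) => [d|] /=; last by lia.
by rewrite size_cat; case: (emit d) => /=; lia.
Qed.

Lemma iter_halted (M : machine) n (c : config M) :
  halting c.1 -> iter n (@step M) c = c.
Proof. by move=> Hc; elim: n => //= n ->; rewrite /step Hc. Qed.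

Lemma simulates_init w : simulates (init_conf w) (step (init tm w)).
Proof.
have E1 : (init tm w).2 work = ([::], [::]).
  by rewrite /init /=; case: eqP => //= /(congr1 val); rewrite /= inordK.
rewrite /step; move: E1; set T := (init tm w).2 => E1.
have -> : (init tm w).1 = inr Boot by [].
rewrite [halting _]/= [trans _ _]/=; split=> //=.
- exact: leq_maxl.
- rewrite !actsE ffunE /write_move /=.
  by case: w @T E1 => [|b w] T E1; [exists [:: None]|exists [::]; rewrite ?cats0].
- by rewrite actsE E1; split => //=; exists [::].
- by rewrite actsE /= !ffunE.
Qed.

Lemma poly_time_interp_fun : poly_time interp_fun.
Proof.
(* With [n] the initial weight, booting costs 1 step, the simulation at most [n], and rewinding at
   most [n + 2]; the total [2 * n + 3] is linear in [size w]. *)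
pose C := 2 * bound.+1 + size hdr + size hdr + 3.
exists tm, C, 1 => w.
set a := init_conf w; set n := weight a.
have [j [Hj Hs Ho]] := simulates_iter (simulates_init w) (leqnn n).
have [] := simulates_stopped Hs (iter_weight_stops (leqnn n)).
rewrite -/(interp_fun w) -iterD -iterSr => Hh Hout.
have Hle : (size (interp_fun w)).+2 + j < C * size w ^ 1 + C.
  by move: Ho Hj; rewrite /= -/(interp_fun w) /n /weight /= expn1 /C; nia.
by rewrite /computes_within -(subnK Hle) iterD iter_halted.
Qed.

Lemma interp_funP w j a : iter j astep (init_conf w) = a -> ~~ anext a ->
  interp_fun w = out a.
Proof.
move=> Hj Ha; rewrite /interp_fun; set n := weight _.
case: (leqP j n) => Hjn.
  by rewrite -(subnK Hjn) iterD Hj iter_stopped.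
by rewrite -Hj -(subnK (ltnW Hjn)) iterD [in RHS]iter_stopped // iter_weight_stops.
Qed.

(** * Programs on sequences of unary numbers *)

Definition leads (a b : aconf) : Prop := exists n, iter n astep a = b.

Lemma leads_refl a : leads a a. Proof. by exists 0. Qed.

Lemma leads_trans b a c : leads a b -> leads b c -> leads a c.
Proof. by move=> [m <-] [n <-]; exists (n + m); rewrite iterD. Qed.

Lemma leads_step a b : leads (astep a) b -> leads a b.
Proof. by move=> [n <-]; exists n.+1; rewrite iterSr. Qed.

(** A Hoare-style triple: [p] consumes [x] and emits [y]. Quantifying over the continuation and the
    remaining input makes triples compose. The final counter is left open because every comparison
    begins by resetting it. *)
Definition runs (fl fl' : bool) (p : seq instr) (x y : seq bool) : Prop :=
  forall k p' n w o, exists n',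
    leads (AConf (Control fl k (p ++ p')) n (x ++ w) o)
          (AConf (Control fl' k p') n' w (o ++ y)).

Lemma runs_nil fl : runs fl fl [::] [::] [::].
Proof. by move=> k p' n w o; exists n; rewrite cats0; apply: leads_refl. Qed.

Lemma runs_cat fl1 fl2 fl3 p1 p2 x1 x2 y1 y2 :
  runs fl1 fl2 p1 x1 y1 -> runs fl2 fl3 p2 x2 y2 ->
  runs fl1 fl3 (p1 ++ p2) (x1 ++ x2) (y1 ++ y2).
Proof.
move=> H1 H2 k p' n w o; rewrite -!catA.
have [n1 H1'] := H1 k (p2 ++ p') n (x2 ++ w) o.
have [n2 H2'] := H2 k p' n1 w (o ++ y1).
by exists n2; rewrite [o ++ (_ ++ _)]catA; apply: leads_trans H1' H2'.
Qed.

Lemma runs_emit fl s : runs fl fl (map Emit s) [::] (if fl then s else [::]).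
Proof.
elim: s => [|b s IH]; first by case: fl; apply: runs_nil.
have H1 : runs fl fl [:: Emit b] [::] (if fl then [:: b] else [::]).
  by move=> k p' n w o; exists n; apply: leads_step; rewrite /astep /=;
    case: fl {IH} => /=; apply: leads_refl.
by have := runs_cat H1 IH; case: fl {H1 IH}.
Qed.

Lemma runs_copy fl m :
  runs fl fl [:: Copy] (unary m) (if fl then unary m else [::]).
Proof.
move=> k p' n w o; exists n; elim: m o => [|m IH] o; apply: leads_step.
  by rewrite /astep /=; case: fl => /=; apply: leads_refl.
have -> : o ++ (if fl then unary m.+1 else [::]) =
    (o ++ (if fl then [:: true] else [::])) ++ (if fl then unary m else [::]).
  by rewrite -catA; case: fl {IH}.
by move: (IH (o ++ (if fl then [:: true] else [::]))); rewrite /astep /=; case: fl {IH}.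
Qed.

Lemma runs_copies fl (ms : seq nat) :
  runs fl fl (nseq (size ms) Copy) (flatten (map unary ms))
       (if fl then flatten (map unary ms) else [::]).
Proof.
elim: ms => [|m ms IH]; first by case: fl; apply: runs_nil.
by have := runs_cat (runs_copy fl m) IH; case: fl {IH}.
Qed.

(** [Count] stores [u] and [Compare] decrements once per digit of [v]: the counter is zero at the
    end of [v] if [u = v], positive there if [v < u], and exhausted earlier if [u < v]. Each outcome
    overwrites the flag, so an earlier block cannot silence a later one. *)
Lemma runs_compare fl u v :
  runs fl (u == v) [:: Mark; Count; Compare] (unary u ++ unary v) [::].
Proof.
move=> k p' n w o; rewrite -catA cats0 [_ ++ p']/=.
have Hcount m : leads
    (AConf (Control fl k [:: Count, Compare & p']) m (unary u ++ unary v ++ w) o)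
    (AConf (Control fl k (Compare :: p')) (u + m) (unary v ++ w) o).
  elim: u m => [|u IH] m; apply: leads_step; rewrite /astep /= cats0.
    exact: leads_refl.
  by rewrite addSnnS; apply: IH.
have Hskip m : leads
    (AConf (Control false k (Copy :: p')) 0 (unary m ++ w) o)
    (AConf (Control false k p') 0 w o).
  elim: m => [|m IH]; apply: leads_step; rewrite /astep /= cats0 //.
  exact: leads_refl.
have Hcomp : exists n', leads
    (AConf (Control fl k (Compare :: p')) u (unary v ++ w) o)
    (AConf (Control (u == v) k p') n' w o).
  elim: v u {Hcount} => [|v IH] [|u].
  - by exists 0; apply: leads_step; rewrite /astep /= cats0; apply: leads_refl.
  - by exists u.+1; apply: leads_step; rewrite /astep /= cats0; apply: leads_refl.
  - by exists 0; apply: leads_step; rewrite /astep /= cats0; apply: Hskip.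
  - have [n' H] := IH u; exists n'; apply: leads_step.
    by rewrite /astep /= cats0 eqSS.
have [n' H] := Hcomp; exists n'; apply: leads_step.
rewrite /astep /= cats0; apply: leads_trans H.
by have := Hcount 0; rewrite addn0.
Qed.

Lemma leads_symbol fl (k : nat) n w o : k <= t ->
  leads (AConf (Control fl ord0 [::]) n (unary k ++ w) o)
        (AConf (Control true ord0 (prog (inord k))) n w o).
Proof.
move=> Hk.
(* Generalised to [m] digits already read; the bound keeps [inord] from truncating. *)
have H m : m + k <= t -> leads
    (AConf (Control fl (inord m) [::]) n (unary k ++ w) o)
    (AConf (Control true ord0 (prog (inord (m + k)))) n w o).
  elim: k m {Hk} => [|k IH] m Hm; apply: leads_step; rewrite /astep /= cats0.
    by rewrite addn0; apply: leads_refl.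
  rewrite inordK; last by lia.
  by rewrite -addSnnS; apply: IH; rewrite addSnnS.
have := H 0 Hk; suff -> : inord 0 = ord0 :> 'I_t.+1 by [].
by apply: val_inj; rewrite /= inordK.
Qed.

(** Facts are processed independently. The flag left by a fact is arbitrary, as [leads_symbol]
    restores it to [true]. *)
Lemma interp_funE (T : Type) (s : seq T) (k : T -> nat) (xs ys : T -> seq bool)
    (hx hy : seq bool) :
  runs true true hdr hx hy ->
  (forall a, k a <= t /\
     exists fl, runs true fl (prog (inord (k a))) (xs a) (ys a)) ->
  interp_fun (hx ++ flatten [seq unary (k a) ++ xs a | a <- s]) =
  hy ++ flatten (map ys s).
Proof.
move=> Hh Hs.
have Hfacts fl n o : exists fl' n',
    leads (AConf (Control fl ord0 [::]) n
             (flatten [seq unary (k a) ++ xs a | a <- s]) o)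
          (AConf (Control fl' ord0 [::]) n' [::] (o ++ flatten (map ys s))).
  elim: s fl n o => [|a s IH] fl n o.
    by exists fl, n; rewrite /= cats0; apply: leads_refl.
  have [Hk [fl1 H1]] := Hs a.
  have [n1 Ha] := H1 ord0 [::] n (flatten [seq unary (k a) ++ xs a | a <- s]) o.
  have [fl2 [n2 H2]] := IH fl1 n1 (o ++ ys a).
  exists fl2, n2; rewrite /= -catA.
  apply: leads_trans (leads_symbol _ _ _ _ Hk) _.
  by rewrite cats0 in Ha; apply: leads_trans Ha _; rewrite [o ++ (_ ++ _)]catA.
set w := flatten _ in Hfacts *.
have [n1 H1] := Hh ord0 [::] 0 w [::].
have [fl [n2 H2]] := Hfacts true n1 hy.
rewrite cats0 in H1.
by have [j Hj] := leads_trans H1 H2; apply: interp_funP Hj _.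
Qed.

End Interpreter.

(** * Structures and GMSNP sentences *)

Lemma atom_subst_comp (S : signature) (U V W : Type) (f : U -> V) (g : V -> W)
    (a : atom S U) : atom_subst g (atom_subst f a) = atom_subst (g \o f) a.
Proof.
case: a => R x; rewrite /atom_subst /=; congr (Tagged _ _).
by apply: val_inj; rewrite /= -map_comp.
Qed.

Lemma eq_in_atom_subst (S : signature) (U : eqType) (V : Type) (f g : U -> V)
    (a : atom S U) : {in vars a, f =1 g} -> atom_subst f a = atom_subst g a.
Proof.
case: a => R x E; rewrite /atom_subst /=; congr (Tagged _ _).
by apply: val_inj; apply/eq_in_map.
Qed.

Lemma lit_true_comp (S : signature) (U V : Type) (D : finType)
    (I : interpretation S D) (f : U -> V) (g : V -> D) (l : literal S U) :
  lit_true I g (l.1, atom_subst f l.2) = lit_true I (g \o f) l.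
Proof. by rewrite /lit_true atom_subst_comp. Qed.

Lemma all_impl2 (T : Type) (p q r : pred T) (s : seq T) :
  (forall c, p c -> q c -> r c) -> all p s -> all q s -> all r s.
Proof.
move=> H; elim: s => //= c s IH /andP[Hp ps] /andP[Hq qs].
by rewrite (H c Hp Hq) IH.
Qed.

(** * Invariance of GMSNP sentences under adding isolated elements *)

Section Embedding.

Variables (tau : signature) (A B : structure tau) (g : dom A -> dom B).
Hypothesis g_inj : injective g.
Hypothesis factsB : forall b, holds (@interp _ B) b <->
  exists2 a, holds (@interp _ A) a & b = atom_subst g a.

Definition image_interp (sigma : signature) (J : interpretation sigma (dom A)) :
    interpretation sigma (dom B) :=
  fun X => [set map_tuple g x | x in J X].

Lemma image_interpP sigma (J : interpretation sigma (dom A)) b :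
  holds (image_interp J) b <-> exists2 a, holds J a & b = atom_subst g a.
Proof.
split.
  case: b => X y /imsetP[x Hx /= ->].
  by exists (existT (fun X => (arity X).-tuple (dom A)) X x).
by case=> -[X x] Hx ->; apply/imsetP; exists x.
Qed.

Lemma embedding_Sat (Phi : snp tau) : gmsnp Phi -> Sat Phi A <-> Sat Phi B.
Proof.
move=> gm; split=> -[J HJ]; last first.
  (* From [B] to [A], the existential relations are pulled back along [g]. *)
  exists (fun X => [set x | map_tuple g x \in J X]) => h.
  apply: all_impl2 gm (HJ (g \o h)) => c gm; apply: contra.
  case/and3P: gm => /allP pos /nilP eps _ /and3P[/allP H1 /allP H2 _].
  rewrite /conjunct_true eps andbT; apply/andP; split; apply/allP => l Hl.
    move: (H1 l Hl); rewrite /lit_true pos // !eqb_id => Ha.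
    by apply/factsB; exists (atom_subst h l.2); rewrite ?atom_subst_comp.
  by have := H2 l Hl; rewrite /lit_true -atom_subst_comp /holds /= inE.
have [a0 _] : exists a0 : dom A, a0 \in dom A by apply/card_gt0P/dom_nonempty.
(* From [A] to [B], the relations are pushed forward and [h] is pulled back to [k]. The default [a0]
   is taken only at variables sent outside the image of [g], which occur in no literal of a violated
   conjunct. *)
exists (image_interp J) => h; pose k v := odflt a0 [pick d | g d == h v].
have kE d v : g d = h v -> k v = d.
  move=> E; rewrite /k; case: pickP => [d' /eqP|/(_ d)]; rewrite -E ?eqxx //.
  exact: g_inj.
have kP (S : signature) (a : atom S 'I_(nvars Phi)) (b : atom S (dom A)) :
    atom_subst h a = atom_subst g b ->
    atom_subst k a = b /\ {in vars a, forall v, h v = g (k v)}.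
  case: a b => R x [R' y] E; have ER : R = R' by case: E.
  case: R' / ER y E => y E.
  have {}E : map_tuple h x = map_tuple g y.
    by apply: eq_from_Tagged E.
  have Exy i : h (tnth x i) = g (tnth y i).
    by have := congr1 (fun z => tnth z i) E; rewrite !tnth_map.
  split; last by move=> v /tnthP[i ->]; rewrite (kE (tnth y i)).
  congr (Tagged _ _); apply: eq_from_tnth => i; rewrite tnth_map /=.
  exact: kE.
apply: all_impl2 gm (HJ k) => c gm; apply: contra.
case/and3P: gm => /allP pos /nilP eps /allP guard.
case/and3P => /allP H1 /allP H2 _; rewrite /conjunct_true eps andbT.
have P1 l : l \in input_lits c -> exists2 a, holds (@interp _ A) a &
    atom_subst h l.2 = atom_subst g a.
  by move=> Hl; apply/factsB; have := H1 l Hl; rewrite /lit_true pos // eqb_id.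
have P2 l : l \in exist_lits c -> l.1 -> exists2 a, holds J a &
    atom_subst h l.2 = atom_subst g a.
  by move=> Hl sg; apply/image_interpP; have := H2 l Hl; rewrite /lit_true sg eqb_id.
apply/andP; split; apply/allP => l Hl; rewrite /lit_true.
  by have [a Ha /kP[-> _]] := P1 l Hl; rewrite Ha pos.
case sg : l.1; first by have [a Ha /kP[-> _]] := P2 l Hl sg; rewrite Ha.
(* The guard is a true positive atom, so its variables, hence those of the negated atom, have values
   in the image of [g]. *)
have Hg : {in vars l.2, forall v, h v = g (k v)}.
  have := guard l Hl; rewrite sg /= => /orP[] /hasP[l' Hl'].
    have [a _ /kP[_ E]] := P1 l' Hl'.
    by move=> /allP G v /G; apply: E.
  case/andP => sg' /allP G v /G.
  by have [a _ /kP[_ E]] := P2 l' Hl' sg'; apply: E.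
apply/eqP/negbTE/negP => Ha; have := H2 l Hl; rewrite /lit_true sg => /eqP.
suff -> : holds (image_interp J) (atom_subst h l.2) by [].
apply/image_interpP; exists (atom_subst k l.2) => //.
by rewrite atom_subst_comp; apply: eq_in_atom_subst => v /Hg.
Qed.

End Embedding.

(** * A single relation symbol *)

Section SingleSymbol.

Variable tau : signature.

Definition pos : finType := {i : tau & (bool + 'I_(arity i))%type}.

Definition flag_pos (i : tau) (c : bool) : pos :=
  existT (fun i : tau => (bool + 'I_(arity i))%type) i (inl c).
Definition arg_pos (i : tau) (j : 'I_(arity i)) : pos :=
  existT (fun i : tau => (bool + 'I_(arity i))%type) i (inr j).

Definition tau1 : signature := @Signature unit (fun=> #|pos|).

Definition at_pos (D : Type) (b : #|pos|.-tuple D) (p : pos) : D :=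
  tnth b (enum_rank p).

Definition of_pos (D : Type) (f : pos -> D) : #|pos|.-tuple D :=
  [tuple f (enum_val i) | i < #|pos|].

Lemma at_of_pos (D : Type) (f : pos -> D) : at_pos (of_pos f) =1 f.
Proof. by move=> p; rewrite /at_pos tnth_mktuple enum_rankK. Qed.

Lemma of_at_pos (D : Type) (b : #|pos|.-tuple D) : of_pos (at_pos b) = b.
Proof.
by apply: eq_from_tnth => i; rewrite tnth_mktuple /at_pos enum_valK.
Qed.

Lemma eq_of_pos (D : Type) (f g : pos -> D) : f =1 g -> of_pos f = of_pos g.
Proof. by move=> E; apply: eq_from_tnth => i; rewrite !tnth_mktuple E. Qed.

Lemma map_of_pos (D D' : Type) (h : D -> D') (f : pos -> D) :
  map_tuple h (of_pos f) = of_pos (h \o f).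
Proof. by apply: eq_from_tnth => i; rewrite tnth_map !tnth_mktuple. Qed.

Definition fact1 (D : Type) (b : #|pos|.-tuple D) : atom tau1 D :=
  existT (fun R : tau1 => (arity R).-tuple D) tt b.

(** * Reading a structure over the single symbol as a [tau]-structure *)

Section Decoding.

Variable D : eqType.

Definition active (b : #|pos|.-tuple D) (i : tau) : bool :=
  at_pos b (flag_pos i true) == at_pos b (flag_pos i false).

Definition block (b : #|pos|.-tuple D) (i : tau) : (arity i).-tuple D :=
  [tuple at_pos b (arg_pos j) | j < arity i].

End Decoding.

Definition decode_interp (D : finType) (I : interpretation tau1 D) :
    interpretation tau D :=
  fun i => [set block b i | b in [set b in I tt | active b i]].

Definition decode (B : structure tau1) : structure tau :=
  Structure (decode_interp (@interp _ B)) (dom_nonempty B).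

Lemma decodeP (D : finType) (I : interpretation tau1 D) (a : atom tau D) :
  reflect (exists b, [/\ holds I (fact1 b), active b (tag a) & tagged a = block b (tag a)])
    (holds (decode_interp I) a).
Proof.
apply: (iffP imsetP) => -[b].
  by rewrite inE => /andP[Hb Ha] E; exists b.
by case=> Hb Ha E; exists b => //; rewrite inE Ha andbT.
Qed.

Section Place.

Variables (V W : Type) (a : atom tau V) (own : bool -> W) (g : V -> W)
  (other : pos -> W).

(** Common to the translation of atoms and that of facts. The default of [nth] is never reached,
    since [j] is below the arity. *)
Definition place (p : pos) : W :=
  if tag p == tag a then
    match tagged p with
    | inl c => own c
    | inr j => nth (own true) (map g (tagged a)) j
    end
  else other p.

Lemma place_flag c : place (flag_pos (tag a) c) = own c.
Proof. by rewrite /place eqxx. Qed.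

Lemma place_arg j : place (arg_pos j) = g (tnth (tagged a) j).
Proof.
rewrite /place eqxx /= (tnth_nth (tnth (tagged a) j)) (nth_map (tnth (tagged a) j)) //.
by rewrite size_tuple.
Qed.

Lemma place_other p : tag p != tag a -> place p = other p.
Proof. by rewrite /place => /negbTE->. Qed.

End Place.

(** * Translation of the sentence *)

Section Sentence.

Variable Phi : snp tau.

Definition tau_atom : finType := {R : tau & (arity R).-tuple 'I_(nvars Phi)}.

(* The copy [inr (a, p)] fills position [p] of the atom that replaces [a]; both
   flag positions of the symbol of [a] share one such variable. *)
Definition var1 : finType := ('I_(nvars Phi) + tau_atom * pos)%type.

Definition old_var (x : 'I_(nvars Phi)) : 'I_#|var1| := enum_rank (inl x : var1).

Definition fresh_var (a : tau_atom) (p : pos) : 'I_#|var1| :=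
  enum_rank (inr (a, p) : var1).

Definition trans_atom (a : tau_atom) : atom tau1 'I_#|var1| :=
  fact1 (of_pos (place a (fun=> fresh_var a (flag_pos (tag a) true))
                   old_var (fresh_var a))).

Definition trans_conjunct (c : conjunct tau (exist_sig Phi) 'I_(nvars Phi)) :
    conjunct tau1 (exist_sig Phi) 'I_#|var1| :=
  Conjunct [seq (l.1, trans_atom l.2) | l <- input_lits c]
           [seq (l.1, atom_subst old_var l.2) | l <- exist_lits c] [::].

Definition trans_snp : snp tau1 :=
  Snp [seq trans_conjunct c | c <- conjuncts Phi].

Lemma old_var_guarded (a : tau_atom) x :
  x \in vars a -> old_var x \in vars (trans_atom a).
Proof.
case/tnthP => j ->; apply/tnthP; exists (enum_rank (arg_pos j)).
by symmetry; apply: etrans (at_of_pos _ _) _; rewrite place_arg.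
Qed.

Lemma gmsnp_trans : gmsnp Phi -> gmsnp trans_snp.
Proof.
rewrite /gmsnp /= all_map; apply: sub_all => c.
case/and3P => Hpos _ guard; apply/and3P; split => //=.
  by rewrite all_map.
rewrite all_map; apply/allP => l Hl /=; apply/implyP => sg.
have := elimT allP guard l Hl; rewrite sg /= => /orP[] /hasP[l' Hl' G]; apply/orP.
  left; apply/hasP; exists (l'.1, trans_atom l'.2).
    by apply/mapP; exists l'.
  apply/allP => y /mapP[x Hx ->]; apply: old_var_guarded.
  exact: (elimT allP G).
right; apply/hasP; exists (l'.1, atom_subst old_var l'.2).
  by apply/mapP; exists l'.
case/andP: G => -> /allP G; apply/allP => y /mapP[x Hx ->].
by apply/mapP; exists x => //; apply: G.
Qed.

(** Both domains coincide and existential atoms are merely renamed, so the same [J] serves in both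
    directions. Only the fresh variables need work. *)
Lemma Sat_trans (B : structure tau1) : gmsnp Phi ->
  Sat trans_snp B <-> Sat Phi (decode B).
Proof.
move=> gm; split=> -[J HJ]; exists J => h; last first.
  rewrite /= all_map; apply: all_impl2 gm (HJ (h \o old_var)) => c gm /=.
  apply: contra; case/and3P: gm => /allP Hpos /nilP eps _.
  rewrite /conjunct_true /= !all_map eps /= !andbT => /andP[H1 H2].
  apply/andP; split.
    apply/allP => l Hl; have := elimT allP H1 l Hl.
    rewrite /lit_true /= Hpos // !eqb_id => H; apply/decodeP.
    exists (of_pos (h \o place l.2 (fun=> fresh_var l.2 (flag_pos (tag l.2) true))
                   old_var (fresh_var l.2))); split.
    - by move: H; rewrite /atom_subst /= map_of_pos.
    - by rewrite /active !at_of_pos /= !place_flag.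
    - apply: eq_from_tnth => j.
      by rewrite tnth_map tnth_mktuple at_of_pos /= place_arg.
  by apply: sub_all H2 => l /=; rewrite lit_true_comp.
have [d0 _] : exists d0 : dom B, d0 \in dom B by apply/card_gt0P/dom_nonempty.
(* A fact of [B] whose decoding yields [a] under [h]. It gives the values of the fresh variables of
   [a]; these are distinct for distinct atoms, so the choices do not conflict. The default [d0] is
   for atoms false under [h]. *)
pose wit (a : tau_atom) : option (#|pos|.-tuple (dom B)) :=
  [pick b | [&& holds (@interp _ B) (fact1 b), active b (tag a) &
             map_tuple h (tagged a) == block b (tag a)]].
pose h1 (v : 'I_#|var1|) : dom B :=
  match (enum_val v : var1) with
  | inl x => h x
  | inr (a, p) => if wit a is Some b then at_pos b p else d0
  end.
have h1_old x : h1 (old_var x) = h x by rewrite /h1 /old_var enum_rankK.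
have := HJ h1; rewrite /= all_map; apply: all_impl2 gm => c /= gm.
apply: contra; case/and3P: gm => /allP Hpos /nilP eps _.
rewrite /conjunct_true /= !all_map eps /= !andbT => /andP[H1 H2].
apply/andP; split.
  apply/allP => l Hl; have := elimT allP H1 l Hl.
  rewrite /lit_true /= Hpos // !eqb_id => /decodeP[b0 [Hb0 A0 E0]].
  have [b [Hb A E Ew]] : exists b, [/\ holds (@interp _ B) (fact1 b),
      active b (tag l.2), map_tuple h (tagged l.2) = block b (tag l.2) &
      wit l.2 = Some b].
    rewrite /wit; case: pickP => [b /and3P[Hb A /eqP E]|/(_ b0)].
      by exists b.
    by rewrite Hb0 A0 -E0 /= eqxx.
  suff -> : atom_subst h1 (trans_atom l.2) = fact1 b by [].
  rewrite /atom_subst /= map_of_pos /fact1; congr existT.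
  rewrite -[RHS]of_at_pos; apply: eq_of_pos => -[i x] /=.
  have h1_fresh p : h1 (fresh_var l.2 p) = at_pos b p.
    by rewrite /h1 /fresh_var enum_rankK Ew.
  (* In the block of the atom, one variable fills both flags; it matches [b] at both since that
     block of [b] is active. *)
  have [Ei|Ni] := eqVneq i (tag l.2); last by rewrite place_other.
  move: x; rewrite Ei => -[c'|j].
    rewrite (@place_flag _ _ l.2) h1_fresh.
    by case: c' => //; apply/eqP.
  rewrite (@place_arg _ _ l.2) h1_old -tnth_map.
  have -> : [tuple of map h (tagged l.2)] = block b (tag l.2) by [].
  by rewrite tnth_mktuple.
apply: sub_all H2 => l /=; rewrite lit_true_comp /lit_true.
by rewrite (eq_in_atom_subst (g := h1 \o old_var)) // => x _; rewrite /= h1_old.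
Qed.

End Sentence.

(** * Turning a [tau]-structure into a structure over the single symbol *)

Section Encoding.

Variable A : structure tau.

(** The element of rank 0 is taken so that the reduction can write its number as a constant. *)
Definition rank0 : dom A := enum_val (Ordinal (dom_nonempty A)).

Definition padding (p : pos) : option (dom A) :=
  if tagged p is inl false then Some rank0 else None.

(* The blocks of the other symbols are padded so that their two flags differ. *)
Definition encode_fact (a : atom tau (dom A)) : #|pos|.-tuple (option (dom A)) :=
  of_pos (place a (fun=> None) Some padding).

Definition encode_interp : interpretation tau1 (option (dom A)) :=
  fun=> [set encode_fact a | a in
          [set a : {R : tau & (arity R).-tuple (dom A)} | holds (@interp _ A) a]].

Lemma encode_nonempty : 0 < #|{: option (dom A)}|.
Proof. by rewrite card_option. Qed.

Definition encode : structure tau1 := Structure encode_interp encode_nonempty.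

Lemma encodeP b : reflect (exists2 a, holds (@interp _ A) a & b = encode_fact a)
  (holds (@interp _ encode) (fact1 b)).
Proof.
apply: (iffP imsetP) => -[a]; first by rewrite inE => Ha E; exists a.
by move=> Ha E; exists a; rewrite ?inE.
Qed.

Lemma active_encode_fact a i : active (encode_fact a) i = (i == tag a).
Proof.
rewrite /active !at_of_pos; have [->|Ni] := eqVneq i (tag a).
  by rewrite !place_flag.
by rewrite !place_other.
Qed.

Lemma block_encode_fact a : block (encode_fact a) (tag a) = map_tuple Some (tagged a).
Proof.
apply: eq_from_tnth => j.
by rewrite tnth_mktuple at_of_pos place_arg tnth_map.
Qed.

(** Only the block of the encoded fact is active, so nothing new is decoded and [None] is isolated;
    this is the hypothesis of [embedding_Sat] for [Some]. *)
Lemma decode_encode a' : holds (@interp _ (decode encode)) a' <->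
  exists2 a, holds (@interp _ A) a & a' = atom_subst Some a.
Proof.
split.
  case/decodeP => b [/encodeP[a Ha ->]]; rewrite active_encode_fact.
  case: a' => R x /= /eqP ER; move: x; rewrite ER => x ->.
  by exists a => //; rewrite block_encode_fact.
case=> a Ha ->; apply/decodeP; exists (encode_fact a).
by rewrite active_encode_fact block_encode_fact eqxx; split=> //; apply/encodeP; exists a.
Qed.

Lemma Sat_encode (Phi : snp tau) : gmsnp Phi ->
  Sat Phi A <-> Sat (trans_snp Phi) encode.
Proof.
move=> gm; rewrite Sat_trans //.
exact: (@embedding_Sat tau A (decode encode) Some (@Some_inj _) decode_encode Phi gm).
Qed.

End Encoding.

(** * The reductions *)

Definition numbers (ns : seq nat) : seq bool := flatten (map unary ns).

Lemma numbers_cat ns ms : numbers (ns ++ ms) = numbers ns ++ numbers ms.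
Proof. by rewrite /numbers map_cat flatten_cat. Qed.

Lemma numbers_flatten (T : Type) (F : T -> seq nat) (s : seq T) :
  numbers (flatten (map F s)) = flatten [seq numbers (F a) | a <- s].
Proof. by elim: s => //= a s <-; rewrite numbers_cat. Qed.

Definition ranks (D : finType) (s : seq D) : seq nat :=
  [seq (enum_rank x : nat) | x <- s].

Lemma flatten_map_cons (T U : Type) (F : T -> seq U) a s :
  flatten (map F (a :: s)) = F a ++ flatten (map F s).
Proof. by []. Qed.

Lemma enum_rankE (T : finType) (x : T) : enum_rank x = index x (enum T) :> nat.
Proof. by rewrite -{2}(nth_enum_rank x x) index_uniq ?enum_uniq // -cardE. Qed.

Lemma ranks_enum (T : finType) : ranks (enum T) = iota 0 #|T|.
Proof.
apply: (@eq_from_nth _ 0) => [|i]; first by rewrite size_map size_iota cardE.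
rewrite size_map => Hi; pose x0 := tnth (in_tuple (enum T)) (Ordinal Hi).
by rewrite (nth_map x0) // enum_rankE index_uniq ?enum_uniq // nth_iota -?cardE // cardE.
Qed.

Lemma enum_rank_None (T : finType) : enum_rank (None : option T) = 0 :> nat.
Proof. by rewrite enum_rankE enumT unlock. Qed.

Lemma enum_rank_Some (T : finType) (x : T) :
  enum_rank (Some x) = (enum_rank x).+1 :> nat.
Proof.
rewrite !enum_rankE enumT unlock /= /option_enum -enumT /=.
by rewrite index_map //; apply: Some_inj.
Qed.

(** In the order of the enumeration of [pos], so that codes of facts split into consecutive
    blocks. *)
Definition block_pos (i : tau) : seq pos :=
  [:: flag_pos i true, flag_pos i false & [seq arg_pos j | j <- enum 'I_(arity i)]].

Lemma enum_boolD (T : finType) :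
  enum {: bool + T} = [:: inl true, inl false & map inr (enum T)].
Proof. by rewrite [LHS]enumT unlock /= /sum_enum -!enumT [enum {: bool}]enumT [in LHS]unlock. Qed.

Lemma enum_pos : enum pos = flatten (map block_pos (enum tau)).
Proof.
rewrite [LHS]enumT unlock /= /tag_enum -enumT; congr flatten; apply: eq_map => i.
by rewrite -enumT enum_boolD /= -map_comp.
Qed.

Lemma fact_code1 (D : finType) (b : #|pos|.-tuple D) :
  fact_code (fact1 b) =
  0 :: flatten [seq ranks (map (at_pos b) (block_pos i)) | i <- enum tau].
Proof.
rewrite /fact_code /=; congr (_ :: _).
  by apply/eqP; rewrite -leqn0 -ltnS -[X in _ < X]card_unit.
have -> : vars (fact1 b) = map (at_pos b) (enum pos).
  rewrite -[LHS](map_tnth_enum b) -[RHS]/(map (tnth b \o enum_rank) _) map_comp.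
  congr map; apply: (inj_map val_inj); rewrite val_enum_ord -map_comp.
  exact/esym/ranks_enum.
by rewrite enum_pos map_flatten /ranks map_flatten -!map_comp.
Qed.

Lemma numbers_encoding (S : signature) (A : structure S)
    (s : seq {R : S & (arity R).-tuple (dom A)}) :
  flatten (map unary (#|dom A| :: flatten (map (@fact_code S (dom A)) s))) =
  unary #|dom A| ++ flatten [seq unary (enum_rank (tag a)) ++ numbers (ranks (vars a)) | a <- s].
Proof. by rewrite /= -/(numbers _) numbers_flatten. Qed.

(* The new element [None] has rank 0, so the old ones are renumbered by putting
   one more [true] in front of their unary codes. *)
Definition fwd_block (R i : tau) : seq instr :=
  if i == R then
    map Emit (numbers [:: 0; 0]) ++ flatten (nseq (arity R) [:: Emit true; Copy])
  else map Emit (numbers (0 :: 1 :: nseq (arity i) 0)).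

(** The extra index [#|tau|] names no symbol and gets the empty program. The emitted [unary 0] is
    the number of the single symbol. *)
Definition fwd_prog (k : 'I_#|tau|.+1) : seq instr :=
  if [pick R : tau | enum_rank R == k :> nat] is Some R then
    map Emit (unary 0) ++ flatten (map (fwd_block R) (enum tau))
  else [::].

Definition fwd : seq bool -> seq bool := interp_fun [:: Emit true; Copy] fwd_prog.

Lemma runs_shift t (prog : 'I_t.+1 -> seq instr) m :
  runs prog true true [:: Emit true; Copy] (unary m) (unary m.+1).
Proof.
exact: (runs_cat (runs_emit prog true [:: true]) (runs_copy prog true m)).
Qed.

Lemma encode_fact_block (A : structure tau) (a : atom tau (dom A)) i :
  ranks (map (at_pos (encode_fact a)) (block_pos i)) =
  if i == tag a then 0 :: 0 :: map S (ranks (tagged a))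
  else 0 :: 1 :: nseq (arity i) 0.
Proof.
rewrite /ranks /block_pos /= -!map_comp; case: eqVneq => [->|Ni].
  rewrite !at_of_pos !place_flag enum_rank_None; congr [:: _, _ & _].
  rewrite -[in RHS](map_tnth_enum (tagged a)) -!map_comp; apply: eq_map => j /=.
  by rewrite at_of_pos place_arg enum_rank_Some.
rewrite !at_of_pos !place_other //= enum_rank_None enum_rank_Some enum_valK /=.
congr [:: _, _ & _].
apply: etrans (_ : nseq (size (enum 'I_(arity i))) 0 = _); last by rewrite size_enum_ord.
rewrite enumT; elim: (Finite.enum _) => //= j s ->.
by rewrite at_of_pos place_other // enum_rank_None.
Qed.

Lemma runs_fwd_block (A : structure tau) (a : atom tau (dom A)) i :
  runs fwd_prog true true (fwd_block (tag a) i)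
    (if i == tag a then numbers (ranks (tagged a)) else [::])
    (numbers (ranks (map (at_pos (encode_fact a)) (block_pos i)))).
Proof.
rewrite encode_fact_block /fwd_block; case: eqP => _; last exact: runs_emit.
apply: (runs_cat (x1 := [::]) (y1 := numbers [:: 0; 0])); first exact: runs_emit.
have H ms : runs fwd_prog true true (flatten (nseq (size ms) [:: Emit true; Copy]))
    (numbers ms) (numbers (map S ms)).
  elim: ms => [|m ms IH]; first exact: runs_nil.
  exact: (runs_cat (runs_shift _ m) IH).
by have := H (ranks (tagged a)); rewrite size_map size_tuple.
Qed.

Lemma runs_fwd (A : structure tau) (a : atom tau (dom A)) :
  runs fwd_prog true true (fwd_prog (inord (enum_rank (tag a))))
    (numbers (ranks (tagged a))) (numbers (fact_code (fact1 (encode_fact a)))).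
Proof.
rewrite {2}/fwd_prog; case: pickP => [R|/(_ (tag a))]; last first.
  by rewrite inordK ?eqxx // ltnS ltnW.
rewrite inordK; last by rewrite ltnS ltnW.
move=> /eqP /val_inj /enum_rank_inj ->.
(* Only the block of [tag a] reads input, and by uniqueness it occurs at most once, so the arguments
   are consumed exactly once. *)
have Hblocks s : uniq s -> runs fwd_prog true true
    (flatten (map (fwd_block (tag a)) s))
    (if tag a \in s then numbers (ranks (tagged a)) else [::])
    (numbers (flatten [seq ranks (map (at_pos (encode_fact a)) (block_pos i)) | i <- s])).
  elim: s => [|i s IH]; first by move=> _; apply: runs_nil.
  case/andP=> Hi /IH {}IH; rewrite !flatten_map_cons numbers_cat inE.
  have := runs_cat (runs_fwd_block a i) IH; rewrite eq_sym.
  case: eqP => [E|_] //=; rewrite -E in Hi.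
  by rewrite (negbTE Hi) cats0.
have := Hblocks (enum tau) (enum_uniq _); rewrite mem_enum => Hb.
rewrite fact_code1 -cat1s numbers_cat.
exact: (runs_cat (runs_emit fwd_prog true (unary 0)) Hb).
Qed.

Lemma fwd_encodes (A : structure tau) w : encodes A w -> encodes (encode A) (fwd w).
Proof.
case=> s [Hs ->]; exists [seq fact1 (encode_fact a) | a <- s]; split.
  case=> [[] b]; apply/mapP/encodeP => -[a].
    by rewrite Hs => Ha E; exists a => //; apply: eq_from_Tagged E.
  by move=> Ha ->; exists a; rewrite ?Hs.
rewrite numbers_encoding.
transitivity (unary #|dom A|.+1 ++
  flatten [seq numbers (fact_code (fact1 (encode_fact a))) | a <- s]).
  apply: (interp_funE s (k := fun a => enum_rank (tag a))
    (xs := fun a => numbers (ranks (vars a)))); first exact: runs_shift.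
  by move=> a; split; [exact: ltnW|exists true; apply: runs_fwd].
by rewrite -card_option /= -/(numbers _) numbers_flatten -map_comp.
Qed.

Lemma fwd_reducible (Phi : snp tau) : gmsnp Phi ->
  poly_reducible (Sat Phi) (Sat (trans_snp Phi)).
Proof.
move=> gm; exists fwd; split; first exact: poly_time_interp_fun.
move=> A w /fwd_encodes H; exists (encode A); split=> //.
exact: Sat_encode.
Qed.

(** If the flags differ, the rest of the block runs silently but still consumes the arguments. *)
Definition bwd_block (i : tau) : seq instr :=
  [:: Mark; Count; Compare] ++ map Emit (unary (enum_rank i)) ++ nseq (arity i) Copy.

Definition bwd_prog (k : 'I_1) : seq instr := flatten (map bwd_block (enum tau)).

Definition bwd : seq bool -> seq bool := interp_fun [:: Copy] bwd_prog.

(** An arbitrary fact may have any number of active blocks, so it yields a list of facts;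
    repetitions across facts are allowed in an encoding. *)
Definition decode_facts (D : finType) (b : #|pos|.-tuple D) :
    seq {R : tau & (arity R).-tuple D} :=
  [seq existT (fun R : tau => (arity R).-tuple D) i (block b i)
     | i <- enum tau & active b i].

Lemma runs_bwd_block (D : finType) (b : #|pos|.-tuple D) fl i :
  runs bwd_prog fl (active b i) (bwd_block i)
    (numbers (ranks (map (at_pos b) (block_pos i))))
    (if active b i then unary (enum_rank i) ++ numbers (ranks (block b i)) else [::]).
Proof.
pose u := at_pos b (flag_pos i true); pose v := at_pos b (flag_pos i false).
have -> : active b i = (enum_rank u == enum_rank v :> nat).
  by rewrite /active (inj_eq val_inj) (inj_eq enum_rank_inj).
have -> : ranks (map (at_pos b) (block_pos i)) =
    [:: enum_rank u : nat; enum_rank v : nat] ++ ranks (block b i).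
  by rewrite /ranks /block_pos /= -!map_comp.
rewrite numbers_cat; set eq_uv := (_ == _).
have Hemit := runs_emit bwd_prog eq_uv (unary (enum_rank i)).
have Hcopy := runs_copies bwd_prog eq_uv (ranks (block b i)).
rewrite size_map size_tuple in Hcopy.
have := runs_cat (runs_compare bwd_prog fl (enum_rank u) (enum_rank v))
                 (runs_cat Hemit Hcopy).
rewrite /numbers /= cats0 -/eq_uv.
by case: eq_uv {Hemit Hcopy}.
Qed.

Lemma runs_bwd (D : finType) (b : #|pos|.-tuple D) k : exists fl,
  runs bwd_prog true fl (bwd_prog k)
    (numbers (flatten [seq ranks (map (at_pos b) (block_pos i)) | i <- enum tau]))
    (numbers (flatten (map (@fact_code tau D) (decode_facts b)))).
Proof.
rewrite /decode_facts {2}/bwd_prog.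
(* The initial flag is generalised because each block hands its own comparison result to the
   next. *)
elim: (enum tau) {1}true => [|i s IH] fl; first by exists fl; apply: runs_nil.
have [fl' H] := IH (active b i); exists fl'.
rewrite !flatten_map_cons numbers_cat.
have := runs_cat (runs_bwd_block b fl i) H; congr runs.
by rewrite [filter _ (i :: s)]/=; case: (active b i);
  rewrite // flatten_map_cons [RHS]numbers_cat.
Qed.

Lemma bwd_encodes (B : structure tau1) w : encodes B w -> encodes (decode B) (bwd w).
Proof.
case=> s [Hs ->].
exists (flatten [seq decode_facts (tagged a : #|pos|.-tuple (dom B)) | a <- s]); split.
  case=> R x; apply/flatten_mapP/decodeP => /= [[[[] b]]|[b [Hb Ab ->]]].
    rewrite Hs => Hb /mapP[i]; rewrite mem_filter => /andP[Ab _] E.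
    exists b; have ER : R = i by case: E.
    by move: x E; rewrite ER => x E; split=> //; apply: eq_from_Tagged E.
  exists (fact1 b); first by rewrite Hs.
  by apply/mapP; exists R; rewrite // mem_filter Ab mem_enum.
rewrite numbers_encoding.
pose tup (a : {R : tau1 & (arity R).-tuple (dom B)}) : #|pos|.-tuple (dom B) := tagged a.
have codeE a : unary (enum_rank (tag a)) ++ numbers (ranks (vars a)) =
    unary 0 ++ numbers (flatten
      [seq ranks (map (at_pos (tup a)) (block_pos i)) | i <- enum tau]).
  by case: a => -[] b; have := fact_code1 b => /(congr1 numbers).
rewrite (eq_map codeE).
transitivity (unary #|dom B| ++
  flatten [seq numbers (flatten (map (@fact_code tau (dom B)) (decode_facts (tup a)))) | a <- s]).
  apply: (interp_funE s (k := fun=> 0)); first exact: runs_copy.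
  by move=> a; split=> //; apply: runs_bwd.
rewrite /= -/(numbers _) -numbers_flatten; congr (_ ++ numbers _).
by elim: (s) => //= a s' ->; rewrite map_cat flatten_cat.
Qed.

Lemma bwd_reducible (Phi : snp tau) : gmsnp Phi ->
  poly_reducible (Sat (trans_snp Phi)) (Sat Phi).
Proof.
move=> gm; exists bwd; split; first exact: poly_time_interp_fun.
move=> B w /bwd_encodes H; exists (decode B); split=> //.
exact: Sat_trans.
Qed.

End SingleSymbol.

Theorem theorem2 (tau : signature) :
  exists tau1 : signature,
    #|symbol tau1| = 1 /\
    forall Phi : snp tau, gmsnp Phi -> nontrivial Phi ->
      exists Phi1 : snp tau1,
        gmsnp Phi1 /\ nontrivial Phi1 /\
        poly_equivalent (Sat Phi) (Sat Phi1).
Proof.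
exists (tau1 tau); split; first exact: card_unit.
move=> Phi gm [[A HA] [B HB]]; exists (trans_snp Phi); split; first exact: gmsnp_trans.
split; last by split; [exact: fwd_reducible|exact: bwd_reducible].
(* Nontriviality transfers by encoding a YES and a NO instance. *)
split; first by exists (encode A); apply/(Sat_encode A gm).
by exists (encode B) => /(Sat_encode B gm).
Qed.
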